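(* Let $p,q$ be distinct primes with $q\not\equiv 1\pmod p$. Up to isomorphism, there is a unique left brace of size $p^2q$ with cyclic additive group and with $|\ker\lambda|=pq$. It is $(B,+,\circ)$ with $B=\mathbb{Z}_{p^2}\times\mathbb{Z}_q$ and $$\begin{pmatrix} n\\ m\end{pmatrix}+\begin{pmatrix} s\\ r\end{pmatrix}=\begin{pmatrix} n+s\\ m+r\end{pmatrix},\qquad \begin{pmatrix} n\\ m\end{pmatrix}\circ\begin{pmatrix} s\\ r\end{pmatrix}=\begin{pmatrix} n+s+pns\\ m+r\end{pmatrix}$$ for all $n,s\in\mathbb{Z}_{p^2}$ and $m,r\in\mathbb{Z}_q$. In particular, $(B,\circ)\cong\mathbb{Z}_{p^2q}$.
   Context: A skew (left) brace is a triple $(B,+,\circ)$ where $(B,+)$ and $(B,\circ)$ are groups such that $a\circ(b+c)=a\circ b-a+a\circ c$ for all $a,b,c\in B$; it is a left brace if $(B,+)$ is abelian. The map $\lambda:(B,\circ)\to\mathrm{Aut}(B,+)$, $\lambda_a(b)=-a+a\circ b$, is a group homomorphism, with kernel $\ker\lambda$. Isomorphisms are bijections preserving both operations. *)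

(* Defs.v *)
From HB Require Import structures.
From mathcomp Require Import all_boot all_order all_algebra all_fingroup all_solvable.

Set Implicit Arguments.
Unset Strict Implicit.
Unset Printing Implicit Defensive.

(* As in MathComp's own finite-group interface, one-sided unit and inverse
   axioms are used; with associativity they give the two-sided ones. *)
Record group_law (T : Type) := GroupLaw {
  gop : T -> T -> T;
  gid : T;
  ginv : T -> T;
  gopA : associative gop;
  gop1 : left_id gid gop;
  gopV : left_inverse gid ginv gop
}.

(* The carrier T seen as a finGroupType via the law G. *)
Definition group_of (T : Type) (G : group_law T) : Type := T.

HB.instance Definition _ (T : finType) (G : group_law T) :=
  Finite.on (group_of G).
HB.instance Definition _ (T : finType) (G : group_law T) :=
  Finite_isGroup.Build (group_of G) (gopA G) (gop1 G) (gopV G).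

Record skew_brace (T : Type) := SkewBrace {
  add_law : group_law T;
  circ_law : group_law T;
  brace_compat : forall a b c : T,
    gop circ_law a (gop add_law b c) =
    gop add_law
      (gop add_law (gop circ_law a b) (ginv add_law a)) (gop circ_law a c)
}.

Definition badd (T : Type) (B : skew_brace T) : T -> T -> T := gop (add_law B).
Definition bopp (T : Type) (B : skew_brace T) : T -> T := ginv (add_law B).
Definition bcirc (T : Type) (B : skew_brace T) : T -> T -> T :=
  gop (circ_law B).

Definition add_group (T : finType) (B : skew_brace T) : finGroupType :=
  group_of (add_law B).
Definition circ_group (T : finType) (B : skew_brace T) : finGroupType :=
  group_of (circ_law B).

Definition is_left_brace (T : Type) (B : skew_brace T) : Prop :=
  commutative (badd B).

Definition lambda (T : Type) (B : skew_brace T) (a b : T) : T :=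
  badd B (bopp B a) (bcirc B a b).

Definition ker_lambda (T : finType) (B : skew_brace T) : {set T} :=
  [set a | [forall b, lambda B a b == b]].

Definition brace_iso (T1 T2 : Type) (B1 : skew_brace T1) (B2 : skew_brace T2) :
  Prop :=
  exists f : T1 -> T2,
    [/\ bijective f,
        {morph f : a b / badd B1 a b >-> badd B2 a b} &
        {morph f : a b / bcirc B1 a b >-> bcirc B2 a b}].

(* Main.v *)
Require Import Defs.
From mathcomp Require Import all_boot all_order all_algebra all_fingroup all_solvable.
From mathcomp Require Import ring.

(* Let g generate (C,+) and write lambda_(jg)(g) = e(j) g. Associativity of the
   circle operation gives e(j + e(j) k) = e(j) e(k), and the kernel K of e,
   having order p q, is {jg : p | j}; so e(j) depends only on j mod p. If e(j)
   were not 1 mod p, then k |-> j + e(j) k would have a fixed point mod p, whence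
   e(k) = e(j) e(k) and e(j) = 1. Thus e is a homomorphism from (Z_p,+), so
   e(1) ^ p = 1; as p does not divide q - 1, e(1) = 1 mod q, and writing
   e(1) = 1 + p c one gets e(j) = 1 + p c j mod p ^ 2 with c prime to p.
   Then kg |-> (c k, k) is the isomorphism. The hypothesis on q also
   excludes p = 2, for which the circle group would not be cyclic: the k-th
   circle power of (1, 1) is (k + p 'C(k, 2), k), and 'C(k, 2) is divisible by p
   with k only for odd p. *)

Set Implicit Arguments.
Unset Strict Implicit.
Unset Printing Implicit Defensive.

Import GRing.Theory.

(** * Congruences and powers modulo primes and their squares *)

Lemma eq_natr_Zp m a b : 1 < m -> ((a%:R : 'Z_m)%R == b%:R%R) = (a == b %[mod m]).
Proof. by move=> m_gt1; rewrite -val_eqE /= !val_Zp_nat. Qed.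

Lemma natr_Zp_eq0 m a : 1 < m -> ((a%:R : 'Z_m)%R == 0%R) = (m %| a).
Proof. by move=> m_gt1; rewrite -[0%R]/(0%:R)%R eq_natr_Zp // mod0n. Qed.

Lemma eq_natr_Fp p a b : prime p -> ((a%:R : 'F_p)%R == b%:R%R) = (a == b %[mod p]).
Proof. by move=> p_pr; rewrite -val_eqE /= !val_Fp_nat. Qed.

Lemma eq_modMr d c a b : a = b %[mod d] -> a * c = b * c %[mod d].
Proof. by move=> ab; rewrite -modnMml ab modnMml. Qed.

Lemma eq_modMl d c a b : a = b %[mod d] -> c * a = c * b %[mod d].
Proof. by rewrite ![c * _]mulnC; exact: eq_modMr. Qed.

Lemma eq_mod_dvd d n a b : d %| n -> a = b %[mod n] -> a = b %[mod d].
Proof. by move=> dn ab; rewrite -(modn_dvdm a dn) ab modn_dvdm. Qed.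

(** Fermat gives exponent [q.-1] as well, and the prime [p] does not divide [q.-1], so a Bezout
    relation between the two exponents kills [x]. *)
Lemma expn_eq1_mod p q x : prime p -> prime q -> p <> q -> q <> 1 %[mod p] ->
  x ^ p = 1 %[mod q] -> x = 1 %[mod q].
Proof.
move=> p_pr q_pr pq qp /eqP xp.
have q_gt0 := prime_gt0 q_pr.
have cpq : coprime p q.-1.
  rewrite prime_coprime //; apply: contra_notN qp => pq1; apply/eqP.
  by rewrite eqn_mod_dvd // subn1.
move: xp; rewrite -eq_natr_Fp // natrX => /eqP xp.
apply/eqP; rewrite -eq_natr_Fp //; set y := (x%:R : 'F_q)%R in xp *.
have y0 : (y != 0)%R.
  by apply: contra_eq_neq xp => ->; rewrite expr0n -leqn0 leqNgt prime_gt0 // eq_sym oner_neq0.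
have yq : (y ^+ q.-1 = 1)%R.
  apply: (mulfI y0); rewrite mulr1 -exprS prednK //.
  by apply/eqP; rewrite /y -natrX eq_natr_Fp //; apply/eqP; exact: fermat_little.
have [a _] := Bezoutl q.-1 (prime_gt0 p_pr).
rewrite (eqP cpq) => /dvdnP[t def_t].
have : (y ^+ (1 + a * q.-1) = y)%R.
  by rewrite exprD mulnC exprM yq expr1n mulr1.
by rewrite def_t mulnC exprM xp expr1n => <-.
Qed.

Lemma expn_1addp_mod p c j : (1 + p * c) ^ j = 1 + p * c * j %[mod p ^ 2].
Proof.
elim: j => [|j IHj]; first by rewrite muln0.
rewrite expnS; apply: etrans (eq_modMl _ IHj) _.
have ->: (1 + p * c) * (1 + p * c * j) = c ^ 2 * j * p ^ 2 + (1 + p * c * j.+1) by ring.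
by rewrite modnMDl.
Qed.

(** * Arithmetic of the exponent map *)

(** The four conditions on [e] abstract lambda on the powers of a generator: well defined modulo the
    order, multiplicative for circle, unit-valued, with kernel the multiples of [p]. *)
Lemma exponent_map_normal_form p q (e : nat -> nat) :
    prime p -> prime q -> p <> q -> q <> 1 %[mod p] ->
    (forall j k, j = k %[mod p ^ 2 * q] -> e j = e k %[mod p ^ 2 * q]) ->
    (forall j k, e (j + e j * k) = e j * e k %[mod p ^ 2 * q]) ->
    (forall j, exists k, e k * e j = 1 %[mod p ^ 2 * q]) ->
    (forall j, (e j == 1 %[mod p ^ 2 * q]) = (p %| j)) ->
  exists2 c, coprime p c & forall j,
    e j = 1 + p * c * j %[mod p ^ 2] /\ e j = 1 %[mod q].
Proof.
set N := p ^ 2 * q => p_pr q_pr pq qp emod eM eV eK.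
have p2N : p ^ 2 %| N by exact: dvdn_mulr.
have qN : q %| N by exact: dvdn_mull.
have pN : p %| N by apply: dvdn_trans p2N; rewrite -mulnn dvdn_mulr.
have p_gt0 := prime_gt0 p_pr.
have e_per j k : j = k %[mod p] -> e j = e k %[mod N].
  wlog lejk : j k / j <= k => [W|] /eqP jk.
    by case/orP: (leq_total j k) => /W H; [|symmetry]; apply: H; rewrite (eqP jk).
  move: jk; rewrite eq_sym eqn_mod_dvd // => /[dup] + pd; rewrite -eK => /eqP ed.
  (* As [p] divides [k - j], [e (k - j)] is 1, and [eM] becomes translation invariance. *)
  have := eM (k - j) j; rewrite -[in X in _ = X]modnMml ed modnMml mul1n => <-.
  apply: emod; rewrite -modnDmr -modnMml ed modnMml mul1n modnDmr subnK //.
have e1p j : e j = 1 %[mod p].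
  apply/eqP; apply/negPn/negP => ej1.
  pose d : 'F_p := ((e j)%:R - 1)%R.
  have d0 : d != 0%R by rewrite subr_eq0 -[1%R]/(1%:R)%R eq_natr_Fp.
  (* The solution of [j + e j * k = k] modulo [p]. *)
  pose k : nat := (- (j%:R) / d : 'F_p)%R.
  have kE : (k%:R = - (j%:R) / d :> 'F_p)%R by exact: natr_Zp.
  have fixk : j + e j * k = k %[mod p].
    apply/eqP; rewrite -eq_natr_Fp // natrD natrM kE.
    have -> : ((e j)%:R = d + 1 :> 'F_p)%R by rewrite subrK.
    by apply/eqP; field.
  have ejk := etrans (esym (e_per _ _ fixk)) (eM j k).
  (* [e k] is a unit, so it cancels from [e k = e j * e k]. *)
  have [k' k'k] := eV k; case/negP: ej1; apply/eqP; apply: (eq_mod_dvd pN).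
  have := eq_modMl (e k') ejk; rewrite k'k mulnCA => ->.
  by rewrite -modnMmr k'k modnMmr muln1.
have eD j k : e (j + k) = e j * e k %[mod N].
  rewrite -eM; apply: e_per.
  by rewrite -[RHS]modnDmr -modnMml e1p modnMml mul1n modnDmr.
have eX j : e j = e 1 ^ j %[mod N].
  elim: j => [|j IHj]; first by apply/eqP; rewrite expn0 eK dvdn0.
  by rewrite -addn1 eD addn1 expnSr; exact: eq_modMr.
have e1q : e 1 = 1 %[mod q].
  apply: (@expn_eq1_mod p) => //; apply: (eq_mod_dvd qN).
  by rewrite -eX; apply/eqP; rewrite eK.
(* Positivity makes the truncated difference [e 1 - 1] a true one. *)
have e1_gt0 : 0 < e 1.
  rewrite lt0n; apply: contra_eq_neq (e1p 1) => ->.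
  by rewrite mod0n modn_small ?prime_gt1.
have [c e1E] : exists c, e 1 = 1 + p * c.
  have := e1p 1 => /eqP; rewrite eqn_mod_dvd // => /dvdnP[c cE].
  by exists c; rewrite mulnC -cE subnKC.
exists c => [|j].
  (* If [p] divided [c], [e 1] would be 1 modulo both [p ^ 2] and [q], putting 1 in the kernel. *)
  rewrite prime_coprime //; apply/negP => /dvdnP[b cE].
  suff: e 1 == 1 %[mod N] by rewrite eK dvdn1 => /eqP p1; rewrite p1 in p_pr.
  rewrite /N chinese_remainder.
    by rewrite e1q eqxx andbT e1E cE mulnCA mulnn addnC modnMDl.
  by rewrite coprime_pexpl // prime_coprime // dvdn_prime2 //; apply/eqP.
split.
  by rewrite (eq_mod_dvd p2N (eX j)) e1E expn_1addp_mod.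
by rewrite (eq_mod_dvd qN (eX j)) -modnXm e1q modnXm exp1n.
Qed.

(** * Lambda and its kernel over the additive group *)

Lemma card_group_of (T : finType) (G : group_law T) : #|{: Defs.group_of G}| = #|T|.
Proof. by apply: (@bij_eq_card _ _ (id : Defs.group_of G -> T)); exists id. Qed.

(* [bcirc] and [lambda] retyped on [add_group C], where brace addition is
   written multiplicatively. *)
Definition circg (T : finType) (C : skew_brace T) (a b : add_group C) :
  add_group C := bcirc C a b.
Definition lamg (T : finType) (C : skew_brace T) (a b : add_group C) :
  add_group C := lambda C a b.

Section SkewBraceTheory.

Variables (T : finType) (C : skew_brace T).
Implicit Types a b c : add_group C.
Local Open Scope group_scope.

Lemma circgA : associative (@circg T C).
Proof. exact: (gopA (circ_law C)). Qed.

Lemma circg_mul a b c : circg a (b * c) = circg a b * a^-1 * circg a c.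
Proof. exact: brace_compat. Qed.

Lemma circg_lam a b : circg a b = a * lamg a b.
Proof. by apply: (canRL (mulKVg a)). Qed.

(** Compatibility at [b = c = 1] lets one [circg a 1] cancel. Hence both groups share their neutral
    element. *)
Lemma circg1 a : circg a 1 = a.
Proof.
have := circg_mul a 1 1; rewrite mulg1 -mulgA -{1}[circg a 1]mulg1.
by move=> /mulgI/esym/(canRL (mulKg _)); rewrite invgK mulg1.
Qed.

Lemma circ1g a : circg 1 a = a.
Proof.
have -> : 1 = gid (circ_law C) :> add_group C.
  by rewrite -[LHS](gop1 (circ_law C)); exact: circg1.
exact: (gop1 (circ_law C)).
Qed.

Lemma circVg a : exists b, circg b a = 1.
Proof.
exists (ginv (circ_law C) a).
by rewrite -[RHS](gop1 (circ_law C)) [RHS]circg1; exact: (gopV (circ_law C)).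
Qed.

Lemma lamg_expg a b k : lamg a (b ^+ k) = lamg a b ^+ k.
Proof.
apply: (mulgI a); rewrite -circg_lam.
elim: k => [|k IHk]; first by rewrite !expg0 circg1 mulg1.
by rewrite expgS circg_mul IHk expgS circg_lam !mulgA mulgKV.
Qed.

Lemma lamg_circ a b c : lamg (circg a b) c = lamg a (lamg b c).
Proof.
apply: (mulgI (circg a b)).
by rewrite -circg_lam -circgA [circg b c]circg_lam circg_mul -mulgA.
Qed.

Definition kerg : {set add_group C} := [set a | [forall b, lamg a b == b]].

Lemma kergP a : reflect (forall b, lamg a b = b) (a \in kerg).
Proof. by rewrite inE; apply: eqfunP. Qed.

Lemma card_kerg : #|kerg| = #|ker_lambda C|.
Proof.
rewrite -(card_imset kerg (@inj_id T : injective (id : add_group C -> T))).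
apply: eq_card => a; apply/imsetP/idP => [[b /kergP kb ->]|].
  by rewrite inE; apply/forallP => c; apply/eqP/kb.
by rewrite inE => /forallP ka; exists a => //; apply/kergP => b; apply/eqP/ka.
Qed.

(** Where [lamg a] is trivial, [circg a b] is [a * b], so closure under circle is additive
    closure. *)
Lemma group_set_kerg : group_set kerg.
Proof.
apply/group_setP; split=> [|a b /kergP ka /kergP kb].
  by apply/kergP => b; rewrite -{2}[b]circ1g circg_lam mul1g.
have -> : a * b = circg a b by rewrite circg_lam ka.
by apply/kergP => c; rewrite lamg_circ kb ka.
Qed.
Canonical kerg_group := Group group_set_kerg.

(** An endomorphism of a cyclic group is fixed by the image of a generator, so [lamg a] is encoded
    by one exponent. *)
Lemma lamg_cyclic g : [set: add_group C] = <[g]> ->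
  exists e : add_group C -> nat, [/\
    forall a, lamg a g = g ^+ e a,
    forall a b, e (circg a b) = e a * e b %[mod #[g]] &
    forall a, (e a == 1 %[mod #[g]]) = (a \in kerg)].
Proof.
move=> gT.
have gen a : exists k, a = g ^+ k by apply/cycleP; rewrite -gT inE.
have [e eE] := fin_all_exists (fun a => gen (lamg a g)); exists e; split=> // [a b|a].
  by apply/eqP; rewrite -eq_expg_mod_order -eE lamg_circ !eE lamg_expg eE expgM.
rewrite -eq_expg_mod_order -eE expg1; apply/eqP/kergP => [eg b|->//].
by have [k ->] := gen b; rewrite lamg_expg eg.
Qed.

End SkewBraceTheory.

(** A cyclic group has a single subgroup of each order, so the kernel must be generated by
    [g ^+ p]. *)
Lemma kerg_cyclic (T : finType) (C : skew_brace T) (g : add_group C) p m :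
    0 < p -> 0 < m -> [set: add_group C] = <[g]>%g ->
    #[g]%g = p * m -> #|kerg C| = m ->
  forall j, (g ^+ j \in kerg C)%g = (p %| j).
Proof.
move=> p_gt0 m_gt0 gT og kerC j.
have ogp : #[g ^+ p]%g = m by rewrite orderXdiv og ?dvdn_mulr // mulKn.
have -> : kerg C = <[g ^+ p]>%g.
  apply/eqP; rewrite (@eq_subG_cyclic _ <[g]> (kerg_group C)) ?cycle_cyclic //.
  - by rewrite -orderE ogp; apply/eqP.
  - by rewrite /= -gT subsetT.
  - by rewrite /= -gT subsetT.
apply/cycleP/idP => [[i /eqP]|/dvdnP[i ->]]; last by exists i; rewrite -expgM mulnC.
rewrite -expgM eq_expg_mod_order og => /eqP eq_ji.
have: j = p * i %[mod p].
  by apply: eq_mod_dvd eq_ji; exact: dvdn_mulr.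
by rewrite -modnMml modnn mod0n => /eqP.
Qed.

Lemma circ_cyclic_normal_form (T : finType) (C : skew_brace T) p q (g : add_group C) :
    prime p -> prime q -> p <> q -> q <> 1 %[mod p] ->
    [set: add_group C] = <[g]>%g -> #[g]%g = p ^ 2 * q -> #|kerg C| = p * q ->
  exists2 c, coprime p c & forall j k, exists l,
    [/\ circg (g ^+ j) (g ^+ k) = (g ^+ l)%g,
        l = j + k + p * c * j * k %[mod p ^ 2] & l = j + k %[mod q]].
Proof.
move=> p_pr q_pr pq qp gT og kerC.
have [E [gE EM EK]] := lamg_cyclic gT.
rewrite og in EM EK.
have cE j k : circg (g ^+ j)%g (g ^+ k)%g = (g ^+ (j + E (g ^+ j)%g * k))%g.
  by rewrite circg_lam lamg_expg gE -expgM -expgD.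
have [||||c pc ec] := @exponent_map_normal_form p q (fun j => E (g ^+ j)%g) p_pr q_pr pq qp.
- by move=> j k /eqP; rewrite -og -eq_expg_mod_order => /eqP ->.
- by move=> j k; rewrite -cE EM.
- move=> j; have [b bE] := circVg (g ^+ j)%g.
  have /cycleP[k bk] : b \in <[g]>%g by rewrite -gT inE.
  exists k; rewrite -EM -bk bE; apply/eqP; rewrite EK; exact: (group1 (kerg_group C)).
- move=> j; rewrite EK (@kerg_cyclic _ _ _ p (p * q)) ?muln_gt0 ?prime_gt0 //.
  by rewrite og mulnA mulnn.
exists c => // j k; exists (j + E (g ^+ j)%g * k); split=> //; have [ep eq1] := ec j.
  by rewrite -modnDmr (eq_modMr k ep) modnDmr mulnDl mul1n addnA.
by rewrite -modnDmr (eq_modMr k eq1) modnDmr mul1n.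
Qed.

(** * The model brace *)

Definition pair_add_law (U V : zmodType) : group_law (U * V)%type :=
  @GroupLaw _ +%R 0%R (@GRing.opp _) (@addrA _) (@add0r _) (@addNr _).

Section ModelBrace.

Variables (R : comNzRingType) (V : zmodType) (t : R).
Hypothesis t2 : (t * t = 0)%R.
Local Open Scope ring_scope.

(** [t] stands for [p] in ['Z_(p ^ 2)]; with a general square-zero element the axioms become
    polynomial identities. *)
Definition model_circ (x y : R * V) : R * V :=
  (x.1 + y.1 + t * x.1 * y.1, x.2 + y.2).

(* Since [t ^+ 2 = 0], the inverse of [1 + t * n] is [1 - t * n]. *)
Definition model_inv (x : R * V) : R * V := (- x.1 + t * x.1 ^+ 2, - x.2).

Lemma model_circA : associative model_circ.
Proof. by move=> x y z; congr pair => /=; [ring | rewrite addrA]. Qed.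

Lemma model_circ1 : left_id (0 : R * V) model_circ.
Proof. by case=> n m; congr pair => /=; [ring | rewrite add0r]. Qed.

Lemma model_circV : left_inverse (0 : R * V) model_inv model_circ.
Proof.
case=> n m; congr pair => /=; last by rewrite addNr.
(* The first coordinate expands to [t * t * n ^+ 3]. *)
by rewrite -[RHS](mul0r (n ^+ 3)) -t2; ring.
Qed.

Definition model_circ_law : group_law (R * V)%type :=
  GroupLaw model_circA model_circ1 model_circV.

Lemma model_compat (a b c : R * V) :
  model_circ a (b + c) = model_circ a b + - a + model_circ a c.
Proof.
congr pair => /=; first by ring.
by rewrite [a.2 + b.2]addrC addrK addrCA.
Qed.

Definition model_brace : skew_brace (R * V)%type :=
  @SkewBrace _ (pair_add_law R V) model_circ_law model_compat.

End ModelBrace.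

(** * Tools for cyclicity and counting *)

Lemma cyclic_faithful_expg (gT : finGroupType) (x : gT) :
  (forall k, x ^+ k = 1 -> #|gT| %| k)%g -> cyclic [set: gT].
Proof.
move=> x_faithful; apply/cyclicP; exists x; apply/esym/eqP.
rewrite eqEcard subsetT cardsT -orderE.
by apply: dvdn_leq (order_gt0 x) _; apply: x_faithful; exact: expg_order.
Qed.

(** [2 * 'C(k, 2) = (k - 1) * k], and 2 is prime to an odd [p]. *)
Lemma dvdn_bin2_odd p k : odd p -> p %| k -> p %| 'C(k, 2).
Proof.
move=> p_odd pk; rewrite -(@Gauss_dvdr _ 2) ?coprimen2 //.
by rewrite mul_bin_left bin1 dvdn_mull.
Qed.

Lemma card_Zp_pmul0 p : prime p -> #|[set n : 'Z_(p ^ 2) | p%:R * n == 0]%R| = p.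
Proof.
move=> p_pr; have p_gt0 := prime_gt0 p_pr.
have p2_gt1 : 1 < p ^ 2 by rewrite (ltn_exp2l 0) // prime_gt1.
have lt_p2 (i : 'I_p) : i * p < p ^ 2 by rewrite -mulnn ltn_mul2r p_gt0 ltn_ord.
(* The annihilator of [p] consists of the [p] multiples of [p], enumerated by [f]. *)
pose f (i : 'I_p) : 'Z_(p ^ 2) := (i * p)%:R%R.
have f_inj : injective f.
  move=> i j /eqP; rewrite eq_natr_Zp // !modn_small // eqn_pmul2r //.
  by move/eqP/val_inj.
rewrite -[RHS]card_ord -cardsT -(card_imset _ f_inj).
apply: eq_card => n; rewrite inE.
have -> : (p%:R * n = (p * n)%:R)%R by rewrite natrM natr_Zp.
have dvd_p2 k : (p ^ 2 %| p * k) = (p %| k) by rewrite -mulnn dvdn_pmul2l.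
rewrite natr_Zp_eq0 // dvd_p2.
apply/dvdnP/imsetP => [[i nE]|[i _ ->]].
  have lt_ip : i < p.
    by rewrite -(ltn_pmul2r p_gt0) -nE mulnn -[X in _ < X](Zp_cast p2_gt1) ltn_ord.
  by exists (Ordinal lt_ip); rewrite // /f /= -nE natr_Zp.
by exists i; rewrite val_Zp_nat // modn_small.
Qed.

(** * Uniqueness: the isomorphism onto the model *)

Lemma model_brace_iso (T : finType) (C : skew_brace T) p q
    (t2 : (p%:R * p%:R = 0 :> 'Z_(p ^ 2))%R) :
  prime p -> prime q -> p <> q -> q <> 1 %[mod p] ->
  #|T| = p ^ 2 * q -> cyclic [set: add_group C] -> #|ker_lambda C| = p * q ->
  brace_iso C (model_brace 'Z_q t2).
Proof.
move=> p_pr q_pr pq qp cardT /cyclicP[g gT] kerC.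
have p2_gt1 : 1 < p ^ 2 by rewrite (ltn_exp2l 0) // prime_gt1.
have q_gt1 := prime_gt1 q_pr.
have cop : coprime (p ^ 2) q.
  by rewrite coprime_pexpl // prime_coprime // dvdn_prime2 //; apply/eqP.
have og : #[g]%g = p ^ 2 * q.
  by rewrite -cardT orderE -gT cardsT card_group_of.
rewrite -card_kerg in kerC.
have [c pc cE] := circ_cyclic_normal_form p_pr q_pr pq qp gT og kerC.
have gen a : exists k, a = (g ^+ k)%g by apply/cycleP; rewrite -gT inE.
have [l lE] := fin_all_exists gen.
pose h k : 'Z_(p ^ 2) * 'Z_q := ((c * k)%:R, k%:R)%R.
pose f (a : add_group C) := h (l a).
(* By the Chinese remainder theorem and since [c] is a unit modulo [p ^ 2]; this makes [f] both well
   behaved on powers and injective. *)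
have hE j k : (h j == h k) = (g ^+ j == g ^+ k)%g.
  rewrite eq_expg_mod_order og chinese_remainder // -pair_eqE /= !eq_natr_Zp //.
  congr andb; rewrite -2!(eq_natr_Zp _ _ p2_gt1) !natrM (inj_eq (mulrI _)) //.
  by rewrite unitZpE // coprime_pexpl // coprime_sym coprime_pexpr // coprime_sym.
have fg k : f (g ^+ k)%g = h k by apply/eqP; rewrite hE -lE.
have f_inj : injective f by move=> a b /eqP; rewrite hE -!lE => /eqP.
exists f; split=> [|a b|a b].
- apply: (@inj_card_bij T _ f f_inj).
  by rewrite card_prod !card_ord !Zp_cast // cardT.
- have [j ->] := gen a; have [k ->] := gen b.
  rewrite -[badd C _ _]/(g ^+ j * g ^+ k)%g -expgD !fg.
  by rewrite /h mulnDr !natrD.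
have [j ->] := gen a; have [k ->] := gen b.
rewrite -[bcirc C _ _]/(circg (g ^+ j)%g (g ^+ k)%g).
have [i [-> ip iq]] := cE j k; rewrite !fg.
congr pair; apply/eqP => /=; last by rewrite -natrD eq_natr_Zp // iq.
rewrite -!natrM -!natrD eq_natr_Zp //.
(* Scaling by [c] absorbs the constant: [c * (p * c * j * k)] is [p * (c * j) * (c * k)]. *)
apply/eqP; apply: etrans (eq_modMl c ip) _; congr (_ %% _); ring.
Qed.

(** * Invariants of the model, and the theorem *)

(** Lambda at [(n, m)] scales the first coordinate by [1 + p * n]; evaluating at [(1, 0)] shows that
    the kernel is given by [p * n = 0]. *)
Lemma model_ker_lambda p q (t2 : (p%:R * p%:R = 0 :> 'Z_(p ^ 2))%R) :
  prime p -> 1 < q -> #|ker_lambda (model_brace 'Z_q t2)| = p * q.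
Proof.
move=> p_pr q_gt1.
have -> : ker_lambda (model_brace 'Z_q t2) =
    setX [set n : 'Z_(p ^ 2) | p%:R * n == 0]%R setT.
  apply/setP => -[n m]; rewrite !inE andbT /=.
  have lamE b : lambda (model_brace 'Z_q t2) (n, m) b = (b.1 + p%:R * n * b.1, b.2)%R.
    by congr pair => /=; [ring | rewrite addKr].
  apply/forallP/eqP => [/(_ (1, 0)%R)|pn0 [s r]].
    rewrite lamE => /eqP/(congr1 fst)/(canRL (addKr _)).
    by rewrite [RHS]addNr => <-; exact/esym/mulr1.
  by rewrite lamE pn0 mul0r addr0.
by rewrite cardsX card_Zp_pmul0 // cardsT card_ord Zp_cast.
Qed.

Lemma cyclic_model_add p q (t2 : (p%:R * p%:R = 0 :> 'Z_(p ^ 2))%R) :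
  1 < p ^ 2 -> 1 < q -> coprime (p ^ 2) q ->
  cyclic [set: add_group (model_brace 'Z_q t2)].
Proof.
move=> p2_gt1 q_gt1 cop.
apply: (@cyclic_faithful_expg _ ((1, 1)%R : add_group (model_brace 'Z_q t2))) => k.
have -> : (((1, 1)%R : add_group (model_brace 'Z_q t2)) ^+ k)%g = (k%:R, k%:R)%R.
  elim: k => // k IHk; rewrite expgS IHk -[(_ * _)%g]/(1 + k%:R, 1 + k%:R)%R.
  by rewrite -!mulrS.
have -> : #|add_group (model_brace 'Z_q t2)| = p ^ 2 * q.
  by rewrite card_group_of card_prod !card_ord !Zp_cast.
by move=> [/eqP + /eqP]; rewrite !natr_Zp_eq0 // Gauss_dvd // => -> ->.
Qed.

Lemma cyclic_model_circ p q (t2 : (p%:R * p%:R = 0 :> 'Z_(p ^ 2))%R) :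
  odd p -> 1 < p -> 1 < q -> coprime (p ^ 2) q ->
  cyclic [set: circ_group (model_brace 'Z_q t2)].
Proof.
move=> p_odd p_gt1 q_gt1 cop.
have p2_gt1 : 1 < p ^ 2 by rewrite (ltn_exp2l 0).
apply: (@cyclic_faithful_expg _ ((1, 1)%R : circ_group (model_brace 'Z_q t2))) => k.
have -> : (((1, 1)%R : circ_group (model_brace 'Z_q t2)) ^+ k)%g =
    ((k + p * 'C(k, 2))%:R, k%:R)%R.
  elim: k => [|k IHk]; first by rewrite expg0 bin0n muln0.
  rewrite expgS IHk; congr pair => /=; last by rewrite -mulrS.
  rewrite binS bin1 !natrD !natrM !natrD mulrS.
  transitivity (1 + k%:R + p%:R * ('C(k, 2)%:R + k%:R) +
     p%:R * p%:R * 'C(k, 2)%:R : 'Z_(p ^ 2))%R; first by ring.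
  by rewrite t2 mul0r addr0.
have -> : #|circ_group (model_brace 'Z_q t2)| = p ^ 2 * q.
  by rewrite card_group_of card_prod !card_ord !Zp_cast.
move=> [/eqP + /eqP]; rewrite !natr_Zp_eq0 // Gauss_dvd // => p2k ->; rewrite andbT.
(* First [p] divides [k]; then it divides ['C(k, 2)], so [p ^ 2] divides [p * 'C(k, 2)] and
   therefore [k]. *)
have pk : p %| k.
  have /(dvdn_trans (dvdn_exp2l p (isT : 1 <= 2))) := p2k.
  by rewrite expn1 addnC dvdn_addr // dvdn_mulr.
move: p2k; rewrite addnC dvdn_addr // -mulnn.
by rewrite dvdn_mul ?dvdn_bin2_odd.
Qed.

Theorem theorem3p2 (p q : nat) (p_pr : prime p) (q_pr : prime q)
    (p_neq_q : p <> q) (q_mod_p : q <> 1 %[mod p]) :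
  exists B : skew_brace ('Z_(p ^ 2) * 'Z_q)%type,
    [/\ forall (n s : 'Z_(p ^ 2)) (m r : 'Z_q),
          badd B (n, m) (s, r) = (n + s, m + r)%R,
        forall (n s : 'Z_(p ^ 2)) (m r : 'Z_q),
          bcirc B (n, m) (s, r) = (n + s + p%:R * n * s, m + r)%R,
        [/\ is_left_brace B,
            #|{: 'Z_(p ^ 2) * 'Z_q}| = p ^ 2 * q,
            cyclic [set: add_group B] &
            #|ker_lambda B| = p * q],
        forall (T : finType) (C : skew_brace T),
          is_left_brace C ->
          #|T| = p ^ 2 * q ->
          cyclic [set: add_group C] ->
          #|ker_lambda C| = p * q ->
          brace_iso C B &
        [set: circ_group B] \isog [set: 'Z_(p ^ 2 * q)]].
Proof.
have p_gt1 := prime_gt1 p_pr; have q_gt1 := prime_gt1 q_pr.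
have p2_gt1 : 1 < p ^ 2 by rewrite (ltn_exp2l 0).
have N_gt1 : 1 < p ^ 2 * q by rewrite (leq_trans p2_gt1) // leq_pmulr // ltnW.
have cop : coprime (p ^ 2) q.
  by rewrite coprime_pexpl // prime_coprime // dvdn_prime2 //; apply/eqP.
have p_odd : odd p.
  (* For [p = 2], [q] is either 2 or odd, hence 1 modulo [p]; both are excluded. *)
  have [p2|//] := even_prime p_pr; subst p; case: q_mod_p.
  by have [q2|oq] := even_prime q_pr; [case: p_neq_q | rewrite modn2 oq].
have t2 : (p%:R * p%:R = 0 :> 'Z_(p ^ 2))%R by rewrite -natrM mulnn pchar_Zp.
have cardB : #|{: 'Z_(p ^ 2) * 'Z_q}| = p ^ 2 * q.
  by rewrite card_prod !card_ord !Zp_cast.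
exists (model_brace 'Z_q t2); split=> // [||].
- split=> //; [exact: addrC | exact: cyclic_model_add | exact: model_ker_lambda].
- by move=> T C _; exact: model_brace_iso.
have cycB := @cyclic_model_circ p q t2 p_odd p_gt1 q_gt1 cop.
rewrite (isog_cyclic_card [group of [set: _]] cycB) /=; apply/andP; split.
  by apply/cyclicP; exists Zp1; exact: Zp_cycle.
by rewrite !cardsT card_group_of cardB card_ord Zp_cast.
Qed.
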